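(* Let $M\in\{\mathrm{Equal\text{-}Split},\mathrm{MES\text{-}Style}\}$ and let $k$ be a positive integer. Then there exist a mixed voting rule $\mathcal{R}$ with $\mathrm{MES}^M$ as a constituent rule, an instance, and an input (rule budgets and a set of pre-selected projects) such that, with $\alpha$ denoting the available budget share of $\mathrm{MES}^M$ in the execution of $\mathcal{R}$, the outcome of $\mathcal{R}$ does not satisfy $\alpha$-budget EJR up to $k$ projects. Moreover, if $k=1$ or $M=\mathrm{MES\text{-}Style}$, this holds even when $\mathrm{MES}^M$ is required to be the second rule in $\mathcal{R}$, the first rule in $\mathcal{R}$ is required to be Greedy, with $\mathcal{R}$ started from the empty set of pre-selected projects, and with Greedy and MES both breaking ties in favor of projects of larger cost.
   Context: Instances. An instance $I=(B,P,A,c)$ consists of a budget $B\in\mathbb{R}_{>0}$, a finite set $P$ of projects, an approval profile $A=(A_1,\dots,A_n)$ of voters $N=\{1,\dots,n\}$ with $A_i\subseteq P$, and costs $c:P\to\mathbb{R}_{>0}$. Write $c(P')=\sum_{p\in P'}c(p)$ and $N_p=\{i\in N: p\in A_i\}$; it is assumed that $N_p\ne\emptyset$ for all $p\in P$. Voting rules. A voting rule $R$ takes an instance $I$, a rule budget $0<B_R\le B$, and a set $P_0\subseteq P$ of pre-selected projects with $c(P_0)\le B_R$, and outputs a set $R(I,B_R,P_0)=P^*$ with $P_0\subseteq P^*\subseteq P$ and $c(P^* )\le B_R$. Mixed rules. A mixed voting rule $\mathcal{R}=[R_1,\dots,R_m]$ takes an instance $I$, rule budgets $0<B_1\le\dots\le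 B_m\le B$, and a set $P_0\subseteq P$ with $c(P_0)\le B_1$. It computes $P_j=R_j(I,B_j,P_{j-1})$ for $j=1,\dots,m$, and its outcome is $P_m$. The available budget share of $R_j$ is $\alpha=(B_j-c(P_{j-1}))/B$; the set of pre-selected projects for $R_j$ is $P_{j-1}$. Greedy. Given rule budget $B_G$ and pre-selected set $P_0$, start from the selected set $P_0$ and iteratively add an unselected project $p$ with the largest $|N_p|$ among those that are affordable (adding $p$ keeps the total cost at most $B_G$), until no affordable unselected project remains. $\mathrm{MES}^M$ (Method of Equal Shares with pre-allocation method $M$). Given rule budget $B_{\mathrm{MES}}$ and pre-selected set $P_0$, let $\alpha=(B_{\mathrm{MES}}-c(P_0))/B$. (1) $M$ determines voter payments $\pi_i\ge 0$ with $\sum_i\pi_i\le c(P_0)$. (2) Voter budgets $(b_i)_{i\in N}$ are chosen to maximize $\min_{i\in N}(\pi_i+b_i)$ subject to $\sum_i b_i=\alpha B$ and $b_i\ge0$. (3) Starting from the selected set $P_0$, repeat: for each unselected project $p$ with $\sum_{i\in N_p}b_i\ge c(p)$ let $\rho(p)$ be the smallest number with $\sum_{i\in N_p}\min(b_i,\rho(p)c(p))=c(p)$; add to the selected set a project $p$ with minimum $\rho(p)$ and replace $b_i$ by $b_i-\min(b_i,\rho(p)c(p))$ for $i\in N_p$. Stop when $\sum_{i\in N_p}b_i<c(p)$ for every unselected $p$; the selected set is the outcome. Pre-allocation methods. Equal-Split: $\pi_i=\sum_{p\in A_i\cap P_0}\frac{c(p)}{|N_p|}$. MES-Style: fix any order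 on $P_0$ (the result is asserted regardless of the order); start with auxiliary budgets $b^0_i=B_{\mathrm{MES}}/n$ and process the projects $p\in P_0$ in this order: if $\sum_{i\in N_p}b^0_i\ge c(p)$, each $i\in N_p$ pays $\min(b^0_i,\rho c(p))$ where $\rho$ is smallest with $\sum_{i\in N_p}\min(b^0_i,\rho c(p))=c(p)$; otherwise each $i\in N_p$ pays all of $b^0_i$ (and the remaining cost is discarded); payments are deducted from $b^0_i$. Then $\pi_i$ is the total amount paid by $i$. Axiom. For $T\subseteq P$, a group $N'\subseteq N$ is $\beta$-budget $T$-cohesive if $T\subseteq\bigcap_{i\in N'}A_i$ and $c(T)\le\frac{|N'|}{n}\beta B$. A set $P^*\subseteq P$ satisfies $\beta$-budget EJR up to $k$ projects if for every $T\subseteq P$ and every $\beta$-budget $T$-cohesive group $N'$, either $|T\cap P^*|>|T|-k$, or there exist $i\in N'$ and $P'\subseteq A_i\cap(P\setminus P^* )$ with $|P'|\le k$ such that $c(A_i\cap P^* )+c(P')>c(T)$. *)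

(* Defs.v *)
From HB Require Import structures.
From mathcomp Require Import all_boot all_order all_algebra.
From mathcomp Require Import boolp reals.
From mathcomp Require Import lra.

Set Implicit Arguments.
Unset Strict Implicit.
Unset Printing Implicit Defensive.

Import Order.TTheory GRing.Theory Num.Theory.
Local Open Scope ring_scope.

Record instance (R : realType) := Instance {
  budget : R;
  project : finType;
  nvoter : nat;
  approval : 'I_nvoter -> {set project};
  cost : project -> R;
  budget_gt0 : 0 < budget;
  nvoter_gt0 : (0 < nvoter)%N;
  cost_gt0 : forall p, 0 < cost p;
  supported : forall p, exists i, p \in approval i
}.

Section Rules.

Variable R : realType.

Section Instance.

Variable I : instance R.

Definition voter := 'I_(nvoter I).

Definition cost_set (S : {set project I}) : R := \sum_(p in S) cost p.

Definition supporters (p : project I) : {set voter} :=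
  [set i | p \in approval i].

Definition valid_rule_input (BR : R) (P0 : {set project I}) : Prop :=
  0 < BR <= budget I /\ cost_set P0 <= BR.

End Instance.

Record voting_rule := VotingRule {
  rule_fun :> forall I : instance R, R -> {set project I} -> {set project I};
  rule_funP : forall (I : instance R) (BR : R) (P0 : {set project I}),
    valid_rule_input BR P0 ->
    P0 \subset rule_fun BR P0 /\ cost_set (rule_fun BR P0) <= BR
}.

(* A mixed rule [R_1, ..., R_m] is the sequence of its constituents.  Positions
   are counted from 0: [mixed_stage rs Bs P0 j] is the set P_j computed by the
   first j constituents, i.e. the pre-selected set of the constituent at
   position j. *)
Fixpoint mixed_outcome (I : instance R) (rs : seq voting_rule) (Bs : seq R)
    (P0 : {set project I}) : {set project I} :=
  match rs, Bs with
  | r :: rs', B :: Bs' => mixed_outcome rs' Bs' (r I B P0)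
  | _, _ => P0
  end.

Definition mixed_stage (I : instance R) (rs : seq voting_rule) (Bs : seq R)
    (P0 : {set project I}) (j : nat) : {set project I} :=
  mixed_outcome (take j rs) (take j Bs) P0.

Definition valid_mixed_input (I : instance R) (rs : seq voting_rule)
    (Bs : seq R) (P0 : {set project I}) : Prop :=
  [/\ size Bs = size rs,
      sorted <=%R Bs,
      forall B, B \in Bs -> 0 < B <= budget I
    & cost_set P0 <= head 0 Bs].

Definition budget_share (I : instance R) (BR : R) (P0 : {set project I}) : R :=
  (BR - cost_set P0) / budget I.

Definition mixed_share (I : instance R) (rs : seq voting_rule) (Bs : seq R)
    (P0 : {set project I}) (j : nat) : R :=
  budget_share (nth 0 Bs j) (mixed_stage rs Bs P0 j).

(* [ArbitraryTies] leaves every tie-breaking decision free; [LargerCostTies]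
   leaves free only the choice between tied projects of equal cost. *)
Inductive tie_breaking := ArbitraryTies | LargerCostTies.

Section Execution.

Variables (tb : tie_breaking) (I : instance R).

Implicit Types (S : {set project I}) (b : {ffun voter I -> R}).

Definition tie_ok (p q : project I) : Prop :=
  match tb with
  | ArbitraryTies => True
  | LargerCostTies => cost q <= cost p
  end.

Definition greedy_candidate (BR : R) S (p : project I) : bool :=
  (p \notin S) && (cost_set S + cost p <= BR).

(* [greedy_run BR S S'] : S' is a possible outcome when S is already selected. *)
Inductive greedy_run (BR : R) : {set project I} -> {set project I} -> Prop :=
| GreedyStop S :
    (forall p, ~~ greedy_candidate BR S p) -> greedy_run BR S S
| GreedyStep S p S' :
    greedy_candidate BR S p ->
    (forall q, greedy_candidate BR S q ->
       (#|supporters q| <= #|supporters p|)%N /\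
       (#|supporters q| = #|supporters p| -> tie_ok p q)) ->
    greedy_run BR (p |: S) S' -> greedy_run BR S S'.

Definition supporter_budget b (p : project I) : R :=
  \sum_(i in supporters p) b i.

Definition covers b (p : project I) (rho : R) : Prop :=
  \sum_(i in supporters p) Num.min (b i) (rho * cost p) = cost p.

Definition is_rho b (p : project I) (rho : R) : Prop :=
  covers b p rho /\ forall rho', covers b p rho' -> rho <= rho'.

Definition charge b (p : project I) (rho : R) : {ffun voter I -> R} :=
  [ffun i => if i \in supporters p then Num.min (b i) (rho * cost p) else 0].

Definition deduct b (x : {ffun voter I -> R}) : {ffun voter I -> R} :=
  [ffun i => b i - x i].

Definition mes_candidate b S (p : project I) : bool :=
  (p \notin S) && (cost p <= supporter_budget b p).

Inductive mes_run : {ffun voter I -> R} -> {set project I} ->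
    {set project I} -> Prop :=
| MesStop b S :
    (forall p, ~~ mes_candidate b S p) -> mes_run b S S
| MesStep b S p rho S' :
    mes_candidate b S p -> is_rho b p rho ->
    (forall q rho', mes_candidate b S q -> is_rho b q rho' ->
       rho <= rho' /\ (rho' = rho -> tie_ok p q)) ->
    mes_run (deduct b (charge b p rho)) (p |: S) S' -> mes_run b S S'.

End Execution.

Section PreAllocation.

Variable I : instance R.

Implicit Types b x pi : {ffun voter I -> R}.

Definition equal_split (P0 : {set project I}) : {ffun voter I -> R} :=
  [ffun i => \sum_(p in approval i :&: P0) cost p / #|supporters p|%:R].

Definition style_payment b (p : project I) x : Prop :=
  if cost p <= supporter_budget b p
  then exists2 rho, is_rho b p rho & x = charge b p rho
  else x = [ffun i => if i \in supporters p then b i else 0].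

(* [style_run b s pi] : processing the projects of s in order, from auxiliary
   budgets b, each voter i pays pi i in total. *)
Inductive style_run : {ffun voter I -> R} -> seq (project I) ->
    {ffun voter I -> R} -> Prop :=
| StyleNil b : style_run b [::] [ffun=> 0]
| StyleCons b p s x pi :
    style_payment b p x -> style_run (deduct b x) s pi ->
    style_run b (p :: s) [ffun i => x i + pi i].

Definition min_voter (F : voter I -> R) : R :=
  \big[Num.min/F (Ordinal (nvoter_gt0 I))]_i F i.

Definition feasible_budgets (a : R) b : Prop :=
  \sum_i b i = a * budget I /\ forall i, 0 <= b i.

Definition maxmin_budgets (a : R) pi b : Prop :=
  feasible_budgets a b /\
  forall b', feasible_budgets a b' ->
    min_voter (fun i => pi i + b' i) <= min_voter (fun i => pi i + b i).

End PreAllocation.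

Inductive prealloc := EqualSplit | MESStyle.

Definition prealloc_payments (M : prealloc) (I : instance R) (BR : R)
    (P0 : {set project I}) (pi : {ffun voter I -> R}) : Prop :=
  match M with
  | EqualSplit => pi = equal_split P0
  | MESStyle => exists2 s, perm_eq s (enum P0)
                & style_run [ffun=> BR / (nvoter I)%:R] s pi
  end.

(* Greedy and MES^M leave ties (and MES-Style the order on P_0) open, so each
   is a property of voting rules: on every valid input, the outcome is that of
   some execution.  A rule may resolve these choices differently on each
   input. *)
Definition is_greedy (tb : tie_breaking) (r : voting_rule) : Prop :=
  forall (I : instance R) (BR : R) (P0 : {set project I}),
    valid_rule_input BR P0 -> greedy_run tb BR P0 (r I BR P0).

Definition is_MES (M : prealloc) (tb : tie_breaking) (r : voting_rule) : Prop :=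
  forall (I : instance R) (BR : R) (P0 : {set project I}),
    valid_rule_input BR P0 ->
    exists pi b : {ffun voter I -> R},
      [/\ prealloc_payments M BR P0 pi,
          maxmin_budgets (budget_share BR P0) pi b
        & mes_run tb b P0 (r I BR P0)].

Section EJR.

Variable I : instance R.

Definition cohesive (beta : R) (T : {set project I}) (N' : {set voter I}) :
    Prop :=
  T \subset \bigcap_(i in N') approval i /\
  cost_set T <= #|N'|%:R / (nvoter I)%:R * beta * budget I.

(* |T :&: Ps| > |T| - k is written without the subtraction, which is truncated
   on nat. *)
Definition EJR_up_to (beta : R) (k : nat) (Ps : {set project I}) : Prop :=
  forall (T : {set project I}) (N' : {set voter I}), cohesive beta T N' ->
    (#|T| < #|T :&: Ps| + k)%N \/
    exists (i : voter I) (P' : {set project I}),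
      [/\ i \in N', P' \subset approval i :&: ~: Ps, (#|P'| <= k)%N
        & cost_set T < cost_set (approval i :&: Ps) + cost_set P'].

End EJR.

End Rules.

(* [greedy_exists] and [MES_exists] below: rules with the properties
   [is_greedy] and [is_MES] do exist, so quantifying over them is not void. *)
Section NonVacuity.

Variable R : realType.

Lemma ex_min_level (T : finType) (a : T -> R) n (A : {set T}) (s : R) :
  #|A| = n -> 0 < s -> (forall i, 0 <= a i) -> s <= \sum_(i in A) a i ->
  exists x, \sum_(i in A) Num.min (a i) x = s /\
    forall y, \sum_(i in A) Num.min (a i) y = s -> x <= y.
Proof.
move=> + + a0; elim: n A s => [|n IH] A s cA s0 sA.
  move: sA; rewrite (cards0_eq cA) big_set0 => s0'.
  by have := lt_le_trans s0 s0'; rewrite ltxx.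
have [j0 j0A] : exists j, j \in A by apply/card_gt0P; rewrite cA.
pose j := [arg min_(i < j0 in A) a i]%O.
have [jA jm] : j \in A /\ forall i, i \in A -> a j <= a i.
  by rewrite /j; case: arg_minP => // i iA im; split.
have ub (B : {set T}) y : \sum_(i in B) Num.min (a i) y <= #|B|%:R * y.
  rewrite mulr_natl -sumr_const; apply: ler_sum => i _.
  by rewrite ge_min lexx orbT.
have n0 : 0 < n.+1%:R :> R by rewrite ltr0n.
case: (leP s (n.+1%:R * a j)) => hs.
  exists (s / n.+1%:R); split.
    rewrite (eq_bigr (fun=> s / n.+1%:R)) => [|i iA].
      by rewrite sumr_const cA -[LHS]mulr_natr divfK // gt_eqF.
    apply/min_idPr; rewrite ler_pdivrMr // mulrC.
    by apply: le_trans hs _; rewrite ler_pM2l // jm.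
  by move=> y ys; rewrite ler_pdivrMr // -ys mulrC -cA; exact: ub.
have cA' : #|A :\ j| = n by move: (cardsD1 j A); rewrite jA cA => -[].
have ajs : n%:R * a j < s - a j.
  by rewrite ltrBrDr; move: hs; rewrite -natr1 mulrDl mul1r.
have s'0 : 0 < s - a j by apply: le_lt_trans ajs; rewrite mulr_ge0.
have split_sum F : \sum_(i in A) F i = F j + \sum_(i in A :\ j) F i :> R.
  by rewrite (big_setD1 j).
have [|x [xs xm]] := IH (A :\ j) (s - a j) cA' s'0.
  by rewrite lerBlDl -split_sum.
have level (B : {set T}) y r : r <= \sum_(i in B) Num.min (a i) y ->
    #|B|%:R * a j < r -> a j <= y.
  move=> ry h; case: leP => // yj.
  have := lt_le_trans h (le_trans ry (ub B y)).
  by rewrite ltNge ler_wpM2l // ltW.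
exists x; split.
  rewrite split_sum xs (min_idPl _); first by rewrite addrC subrK.
  by apply: (@level (A :\ j) x (s - a j)); rewrite ?xs ?cA'.
move=> y ys; apply: xm.
have jy : a j <= y by apply: (@level A y s); rewrite ?ys ?cA.
by rewrite -ys split_sum (min_idPl jy) addrC addKr.
Qed.

Section Inst.
Variable I : instance R.
Implicit Types (b x pi : {ffun voter I -> R}) (S : {set project I}).

Lemma ex_rho b p : (forall i, 0 <= b i) -> cost p <= supporter_budget b p ->
  exists rho, is_rho b p rho.
Proof.
move=> b0 h; have c0 := cost_gt0 p.
have [x [xs xm]] := ex_min_level erefl c0 b0 h.
exists (x / cost p); split.
  by rewrite /covers divfK ?gt_eqF.
by move=> r /xm; rewrite ler_pdivrMr.
Qed.

Lemma is_rho_uniq b p r r' : is_rho b p r -> is_rho b p r' -> r = r'.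
Proof. by move=> [c m] [c' m']; apply/le_anti; rewrite m // m'. Qed.

Lemma deduct_charge_ge0 b p r : (forall i, 0 <= b i) ->
  forall i, 0 <= deduct b (charge b p r) i.
Proof.
move=> b0 i; rewrite !ffunE; case: ifP => _; last by rewrite subr0.
by rewrite subr_ge0 ge_min lexx.
Qed.

Lemma sum_deduct b x : \sum_i deduct b x i = \sum_i b i - \sum_i x i.
Proof. by rewrite -sumrB; apply: eq_bigr => i _; rewrite ffunE. Qed.

Lemma sum_charge b p r : covers b p r -> \sum_i charge b p r i = cost p.
Proof.
by move=> <-; rewrite [RHS]big_mkcond; apply: eq_bigr => i _; rewrite ffunE.
Qed.

Lemma cost_setU1 S p : p \notin S -> cost_set (p |: S) = cost p + cost_set S.
Proof. by move=> pS; rewrite /cost_set big_setU1. Qed.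

Lemma card_setCU1 S p m : p \notin S -> #|~: S| = m.+1 -> #|~: (p |: S)| = m.
Proof.
move=> pS h; rewrite setCU setIC -setDE.
by move: (cardsD1 p (~: S)); rewrite inE pS h => -[].
Qed.

Lemma ex_tie tb (Q : pred (project I)) p0 : Q p0 ->
  exists2 p, Q p & forall q, Q q -> tie_ok tb p q.
Proof.
move=> Q0; pose p := [arg max_(i > p0 | Q i) cost i]%O.
have [Qp pm] : Q p /\ forall i, Q i -> cost i <= cost p.
  by rewrite /p; case: arg_maxP => // i iA im; split.
by exists p => // q /pm; case: tb.
Qed.

Lemma ex_greedy tb BR S : cost_set S <= BR -> exists S',
  [/\ greedy_run tb BR S S', S \subset S' & cost_set S' <= BR].
Proof.
have [m] := ubnP #|~: S|; elim: m S => // m IH S lm cS.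
have [/existsP[p0 p0c]|/existsPn np] :=
    boolP [exists p, greedy_candidate BR S p]; last first.
  by exists S; split => //; apply: GreedyStop.
case: (arg_maxnP (fun p => #|supporters p|) p0c) => p1 p1c p1m.
pose Q p := greedy_candidate BR S p && (#|supporters p| == #|supporters p1|).
have [|p /andP[pc /eqP pn] pt] := @ex_tie tb Q p1; first by rewrite /Q p1c eqxx.
have /andP[pS pB] := pc.
have [||S' [run sub le]] := IH (p |: S).
- rewrite -ltnS; apply: leq_trans lm; rewrite ltnS; apply: proper_card.
  rewrite setCU setIC -setDE properD1 // inE //.
- by rewrite cost_setU1 // addrC.
exists S'; split=> //; last by apply: subset_trans sub; exact: subsetUr.
apply: GreedyStep pc _ run => q qc; split; first by rewrite pn; exact: p1m.
by move=> qn; apply: pt; rewrite /Q qc qn pn eqxx.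
Qed.

Lemma ex_mes tb BR b S : (forall i, 0 <= b i) ->
  \sum_i b i + cost_set S <= BR -> exists S',
  [/\ mes_run tb b S S', S \subset S' & cost_set S' <= BR].
Proof.
have [m] := ubnP #|~: S|; elim: m b S => // m IH b S lm b0 cS.
have [/existsP[p0 p0c]|/existsPn np] :=
    boolP [exists p, mes_candidate b S p]; last first.
  exists S; split => //; first by apply: MesStop.
  by apply: le_trans cS; rewrite lerDr sumr_ge0.
have [f fP] : exists f : project I -> R,
    forall p, mes_candidate b S p -> is_rho b p (f p).
  suff /boolp.choice[f] : forall p, exists r, mes_candidate b S p -> is_rho b p r.
    by exists f.
  move=> p.
  have [/andP[_ h]|_] := boolP (mes_candidate b S p); last by exists 0.
  by have [r rP] := ex_rho b0 h; exists r.
case: (@arg_minP _ _ _ p0 (mes_candidate b S) f p0c) => p1 p1c p1m.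
pose Q p := mes_candidate b S p && (f p == f p1).
have [|p /andP[pc /eqP pn] pt] := @ex_tie tb Q p1; first by rewrite /Q p1c eqxx.
have /andP[pS pB] := pc; have pr := fP _ pc.
have [|||S' [run sub le]] := IH (deduct b (charge b p (f p))) (p |: S).
- rewrite -ltnS; apply: leq_trans lm; rewrite ltnS; apply: proper_card.
  rewrite setCU setIC -setDE properD1 // inE //.
- exact: deduct_charge_ge0.
- by rewrite cost_setU1 // sum_deduct (sum_charge pr.1) addrA subrK.
exists S'; split=> //; last by apply: subset_trans sub; exact: subsetUr.
apply: MesStep pc pr _ run => q r qc qr.
rewrite (is_rho_uniq qr (fP _ qc)) pn; split; first exact: p1m.
by move=> e; apply: pt; rewrite /Q qc e eqxx.
Qed.

Lemma ex_style b (s : seq (project I)) : (forall i, 0 <= b i) ->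
  exists pi, style_run b s pi.
Proof.
elim: s b => [|p s IH] b b0; first by eexists; exact: StyleNil.
have [x [xP x0]] : exists x, style_payment b p x /\
    forall i, 0 <= deduct b x i.
  rewrite /style_payment; case h: (cost p <= supporter_budget b p).
    have [r rP] := ex_rho b0 h; exists (charge b p r).
    by split; [exists r | exact: deduct_charge_ge0].
  eexists; split; first by [].
  by move=> i; rewrite !ffunE; case: ifP; rewrite ?subrr ?subr0.
have [pi piP] := IH _ x0.
by eexists; apply: StyleCons xP piP.
Qed.

Lemma ex_maxmin a pi : 0 <= a -> exists b, maxmin_budgets a pi b.
Proof.
move=> a0; pose s := a * budget I.
have s0 : 0 <= s by rewrite mulr_ge0 // ltW // budget_gt0.
pose K := s + 1 + \sum_i `|pi i|.
have aK i : s + 1 <= K - pi i.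
  rewrite /K (bigD1 i) //=.
  have : 0 <= \sum_(j | j != i) `|pi j| by rewrite sumr_ge0.
  have := ler_norm (pi i); lra.
have aK0 i : 0 <= K - pi i by have := aK i; lra.
pose i0 : voter I := Ordinal (nvoter_gt0 I).
have sK : s + 1 <= \sum_i (K - pi i).
  rewrite (bigD1 i0) //=.
  have : 0 <= \sum_(j | j != i0) (K - pi j) by rewrite sumr_ge0.
  have := aK i0; lra.
have [||y [yP _]] := @ex_min_level _ (fun i => K - pi i) _ setT
  (\sum_i (K - pi i) - s) erefl _ aK0.
- lra.
- by under [X in _ <= X]eq_bigl do rewrite inE; lra.
move: yP; under eq_bigl do rewrite inE; move=> yP.
pose b := [ffun i => K - pi i - Num.min (K - pi i) y].
have bS : \sum_i b i = s.
  under eq_bigr do rewrite ffunE.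
  by rewrite sumrB yP; lra.
have b0 i : 0 <= b i by rewrite ffunE subr_ge0 ge_min lexx.
exists b; split; first by split.
move=> b' [b'S b'0]; rewrite leNgt; apply/negP => lt.
have lb : K - y <= min_voter (fun i => pi i + b i).
  apply: le_bigmin=> [|i _]; rewrite ffunE.
    have : Num.min (K - pi i0) y <= y by rewrite ge_min lexx orbT.
    rewrite -/i0; lra.
  have : Num.min (K - pi i) y <= y by rewrite ge_min lexx orbT.
  lra.
have bb' i : b i <= b' i.
  have h : min_voter (fun i => pi i + b' i) <= pi i + b' i by exact: bigmin_le.
  rewrite ffunE; case: (leP (K - pi i) y) => _; first by rewrite subrr.
  lra.
have eb : b =1 b'.
  move=> i; apply/eqP; rewrite eq_sym -subr_eq0; apply/eqP.
  apply: (@psumr_eq0P _ _ predT (fun i => b' i - b i)) => //.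
    by move=> j _; rewrite subr_ge0.
  by rewrite sumrB bS b'S subrr.
have e : (fun i => pi i + b i) = (fun i => pi i + b' i).
  by apply: funext => i; rewrite eb.
by move: lt; rewrite e ltxx.
Qed.

End Inst.

Lemma ex_rule (Out : forall I : instance R, R -> {set project I} ->
    {set project I} -> Prop) :
  (forall I BR (P0 : {set project I}), valid_rule_input BR P0 -> exists S,
     [/\ Out I BR P0 S, P0 \subset S & cost_set S <= BR]) ->
  exists r : voting_rule R, forall I BR (P0 : {set project I}),
    valid_rule_input BR P0 -> Out I BR P0 (r I BR P0).
Proof.
move=> H.
pose f (I : instance R) BR (P0 : {set project I}) : {set project I} :=
  match pselect (valid_rule_input BR P0) with
  | left v => sval (cid (H I BR P0 v)) | right _ => set0 end.
have fP I BR (P0 : {set project I}) : valid_rule_input BR P0 ->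
    [/\ Out I BR P0 (f I BR P0), P0 \subset f I BR P0
      & cost_set (f I BR P0) <= BR].
  by move=> v; rewrite /f; case: pselect => // v'; case: cid.
have fP' I BR (P0 : {set project I}) : valid_rule_input BR P0 ->
    P0 \subset f I BR P0 /\ cost_set (f I BR P0) <= BR.
  by case/fP.
by exists (VotingRule fP') => I BR P0 /fP[].
Qed.

Lemma greedy_exists tb : exists r : voting_rule R, is_greedy tb r.
Proof.
by apply: (@ex_rule (fun I => @greedy_run R tb I)) => I BR P0 [_]; exact: ex_greedy.
Qed.

Lemma MES_exists M tb : exists r : voting_rule R, is_MES M tb r.
Proof.
apply: (@ex_rule (fun I BR P0 S => exists pi b, [/\ prealloc_payments M BR P0 pi,
  maxmin_budgets (budget_share BR P0) pi b & mes_run tb b P0 S])).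
move=> I BR P0 [/andP[B0 _] cB].
have [pi piP] : exists pi, prealloc_payments M BR P0 pi.
  case: M => /=; first by eexists.
  have [|pi piP] := @ex_style I [ffun=> BR / (nvoter I)%:R] (enum P0).
    by move=> i; rewrite ffunE divr_ge0 // ltW.
  by exists pi, (enum P0).
have Bg := budget_gt0 I.
have [|b bP] := @ex_maxmin I (budget_share BR P0) pi.
  by rewrite divr_ge0 ?subr_ge0 // ltW.
have [[bS b0] _] := bP.
have [|S [? ? ?]] := @ex_mes I tb BR b P0 b0.
  by rewrite bS /budget_share divfK ?gt_eqF // subrK.
by exists S; split => //; exists pi, b.
Qed.

End NonVacuity.

(* Main.v *)
Require Import Defs.
From HB Require Import structures.
From mathcomp Require Import all_boot all_order all_algebra.
From mathcomp Require Import reals.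
From mathcomp Require Import lra zify.

Set Implicit Arguments.
Unset Strict Implicit.
Unset Printing Implicit Defensive.

Import Order.TTheory GRing.Theory Num.Theory.
Local Open Scope ring_scope.

(** The pre-allocation payments can leave a large cohesive group with almost no
   budget although each member gains little from the pre-selected projects. For
   Equal-Split, let every member of the group be the only supporter of one unit
   cost project: everyone has paid 1, and all the money goes to other voters. To
   have Greedy select projects of small support when k = 1, one project with an
   outside supporter first uses up so much of its budget that the projects of
   the group become unaffordable. For MES-Style, each project of a member is
   also supported by a common set O, as large as the group; Greedy then prefers
   these projects to those of the group. They are so expensive that O is
   exhausted after few of them, in any order, so most members have to give up
   their whole auxiliary budget. *)

(** * When Greedy ends with a prescribed set and MES buys nothing *)

Section Executions.

Variables (R : realType) (I : instance R).
Implicit Types (b x pi : {ffun voter I -> R}) (X S : {set project I}).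

(** As all of [X] fits into [BR], its remaining projects stay affordable, so Greedy can neither
    leave [X] nor stop early. Strict comparison of supports makes tie-breaking immaterial. *)
Lemma greedy_run_outcome tb BR X S S' :
  cost_set X <= BR ->
  (forall p S0, p \notin X -> S0 \subset X -> cost_set S0 + cost p <= BR ->
     exists2 q, q \in X :\: S0 & (#|supporters p| < #|supporters q|)%N) ->
  greedy_run tb BR S S' -> S \subset X -> S' = X.
Proof.
move=> XB out; have cand S0 q : S0 \subset X -> q \in X :\: S0 ->
    greedy_candidate BR S0 q.
  move=> SX /setDP[qX qS]; rewrite /greedy_candidate qS /=.
  apply: le_trans XB; rewrite addrC -cost_setU1 // /cost_set.
  rewrite [leRHS](big_setID (q |: S0)) /= (setIidPr _) ?subUset ?sub1set ?qX //.
  by rewrite lerDl sumr_ge0 // => p _; exact/ltW/cost_gt0.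
elim=> {S S'} [S stop SX|S p S' /andP[pS pB] pmax _ IH SX].
  apply/eqP; rewrite eqEsubset SX; apply/subsetP => q qX; apply/negPn/negP=> qS.
  by have := stop q; rewrite cand // inE qS.
apply: IH; rewrite subUset SX sub1set andbT; apply/negPn/negP => pX.
have [q qD] := out p S pX SX pB.
by rewrite ltnNge (pmax q (cand _ _ SX qD)).1.
Qed.

Lemma mes_run_stuck tb b S S' :
  (forall p, ~~ mes_candidate b S p) -> mes_run tb b S S' -> S' = S.
Proof.
move=> + run; case: run => // b0 S0 p rho S1 pc _ _ _ stop.
by have := stop p; rewrite pc.
Qed.

(* Otherwise shift money from a voter above [l] to everybody: as the average of
   [pi i + b i] is at most [l], this raises the minimum. *)
Lemma maxmin_budgets_le (a l : R) pi b :
  (forall i, pi i <= l) ->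
  a * budget I + \sum_i pi i <= (nvoter I)%:R * l ->
  maxmin_budgets a pi b -> forall i, pi i + b i <= l.
Proof.
move=> pil avg [[bS b0] bmax] j; rewrite leNgt; apply/negP => lj.
have n0 : 0 < (nvoter I)%:R :> R by rewrite ltr0n nvoter_gt0.
pose mu := min_voter (fun i => pi i + b i).
have mub i : mu <= pi i + b i by exact: bigmin_le.
(* If all voters were at [l] or above, then with [j] strictly above the total would exceed
   [n * l]. *)
have mul : mu < l.
  rewrite ltNge; apply/negP => lmu.
  suff : (nvoter I)%:R * l < \sum_i (pi i + b i).
    by rewrite big_split /= bS addrC ltNge avg.
  rewrite mulr_natl -{1}(card_ord (nvoter I)) -sumr_const.
  rewrite [ltLHS](bigD1 j) //= [ltRHS](bigD1 j) //=; apply: ltr_leD => //.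
  by apply: ler_sum => i _; apply: le_trans lmu (mub i).
pose ep := pi j + b j - l; pose d := ep / (nvoter I)%:R.
have ep0 : 0 < ep by rewrite subr_gt0.
have d0 : 0 < d by rewrite divr_gt0.
have epb : ep <= b j by rewrite /ep; have := pil j; lra.
pose b' := [ffun i => b i + d - (if i == j then ep else 0)].
have feas : feasible_budgets a b'.
  split=> [|i]; last by rewrite ffunE; case: eqP => [->|_]; have := b0 i; lra.
  under eq_bigr do rewrite ffunE.
  rewrite big_split big_split /= bS sumrN -big_mkcond big_pred1_eq sumr_const.
  by rewrite card_ord -mulr_natr divfK ?gt_eqF // addrK.
have := bmax _ feas; rewrite leNgt => /negP; apply.
(* Voter [j] ends at exactly [l + d], everybody else at [mu + d] or more; both exceed [mu]. *)
apply: (@lt_le_trans _ _ (Num.min (mu + d) (l + d))).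
  by rewrite lt_min -/mu; apply/andP; split; lra.
have key i : Num.min (mu + d) (l + d) <= pi i + b' i.
  rewrite ffunE ge_min; apply/orP; case: eqP => [->|_]; [right|left].
    by rewrite /ep; lra.
  by have := mub i; lra.
by apply: le_bigmin => [|i _]; exact: key.
Qed.

(** Payments and voter budgets together amount to at most [BR], so no voter is lifted above the
    level [l]. The supporters of [p] then hold at most the sum of [l - pi i], less than its cost. *)
Lemma MES_stuck (M : prealloc) tb (mes : voting_rule R) (BR l : R) X :
  is_MES M tb mes -> valid_rule_input BR X -> BR <= (nvoter I)%:R * l ->
  (forall pi, prealloc_payments M BR X pi ->
     [/\ forall i, pi i <= l, \sum_i pi i <= cost_set X &
         forall p, p \notin X -> \sum_(i in supporters p) (l - pi i) < cost p]) ->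
  mes I BR X = X.
Proof.
move=> mesP val BRl H; have [pi [b [/H[pil piX poor] bm run]]] := mesP _ _ _ val.
apply: mes_run_stuck run => p; apply/negP => /andP[pX].
rewrite leNgt => /negP; apply; apply: le_lt_trans (poor p pX).
apply: ler_sum => i _.
suff : pi i + b i <= l by lra.
apply: maxmin_budgets_le bm i => //.
rewrite /budget_share divfK ?gt_eqF ?budget_gt0 //; lra.
Qed.

(** * Payments under Equal-Split and MES-Style *)

Lemma sum_equal_split X : \sum_i equal_split X i = cost_set X.
Proof.
under eq_bigr => i _.
  rewrite ffunE (eq_bigl (fun p => (p \in X) && (i \in supporters p))) => [|p];
    last by rewrite !inE andbC.
  over.
rewrite (exchange_big_dep (mem X)) /=; last by move=> i p _ /andP[].
apply: eq_bigr => p pX; under eq_bigl do rewrite pX.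
have [i ip] := supported p.
rewrite sumr_const -[LHS]mulr_natr divfK // pnatr_eq0 -lt0n.
by apply/card_gt0P; exists i; rewrite inE.
Qed.

Lemma style_payment_bounds b p x : (forall i, 0 <= b i) ->
  style_payment b p x ->
  [/\ forall i, 0 <= x i <= b i, \sum_i x i <= cost p &
      (forall i, i \in supporters p -> x i = b i) \/ \sum_(i in supporters p) x i = cost p].
Proof.
move=> b0; rewrite /style_payment; have c0 := cost_gt0 p; case: ifPn => [_|poor].
  move=> [rho [cov _] ->]; split.
  (* [is_rho] ranges over all reals, but a negative [rho] cannot cover a positive cost. *)
  - have rho0 : 0 <= rho.
      rewrite leNgt; apply/negP => rho0; move: c0; rewrite -cov ltNge => /negP.
      apply; apply: sumr_le0 => i _; rewrite ge_min.
      by rewrite pmulr_lle0 ?cost_gt0 // (ltW rho0) orbT.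
    move=> i; rewrite ffunE; case: ifP => _; last by rewrite lexx b0.
    by rewrite ge_min lexx le_min b0 mulr_ge0 // ltW.
  - by rewrite (sum_charge cov).
  - by right; rewrite -[RHS]cov; apply: eq_bigr => i ip; rewrite ffunE ip.
move=> ->; split.
- by move=> i; rewrite ffunE; case: ifP; rewrite !lexx b0.
- rewrite (eq_bigr _ (fun i _ => ffunE _ i)) -big_mkcond ltW // ltNge.
  exact: poor.
- by left => i ip; rewrite ffunE ip.
Qed.

Lemma style_run_bounds b s pi : style_run b s pi -> (forall i, 0 <= b i) ->
  (forall i, 0 <= pi i <= b i) /\ \sum_i pi i <= \sum_(p <- s) cost p.
Proof.
elim=> {b s pi} [b b0|b p s x pi xP _ IH b0].
  by split=> [i|]; [rewrite ffunE lexx b0 | rewrite big_nil big1 // => i _; rewrite ffunE].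
have [xb xc _] := style_payment_bounds b0 xP.
have [|pib pic] := IH; first by move=> i; rewrite ffunE subr_ge0; case/andP: (xb i).
split=> [i|].
  by rewrite ffunE; have := xb i; have := pib i; rewrite ffunE; lra.
by rewrite big_cons (eq_bigr _ (fun i _ => ffunE _ i)) big_split lerD.
Qed.

(* A project that is not fully paid exhausts its owner; one that is fully paid
   costs the common supporters [O] at least [c - l]. *)
Lemma style_run_exhausts (O : {set voter I}) (own : project I -> voter I)
    (c l : R) b s pi :
  0 <= l <= c ->
  style_run b s pi -> (forall i, 0 <= b i <= l) ->
  (forall p, p \in s ->
     [/\ supporters p = own p |: O, own p \notin O & cost p = c]) ->
  (c - l) * \sum_(p <- s) (b (own p) - pi (own p)) <= l * \sum_(i in O) b i.
Proof.
move=> /andP[l0 lc]; elim=> {b s pi} [b b0 _|b p s x pi xP run IH bl sP].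
  by rewrite big_nil mulr0 mulr_ge0 // sumr_ge0 // => i _; case/andP: (b0 i).
have b0 i : 0 <= b i by case/andP: (bl i).
have [xb _ xp] := style_payment_bounds b0 xP.
have d0 i : 0 <= deduct b x i by rewrite ffunE; have := xb i; lra.
have [pib _] := style_run_bounds run d0.
have {}IH : (c - l) * \sum_(q <- s) (deduct b x (own q) - pi (own q)) <=
    l * \sum_(i in O) deduct b x i.
  apply: IH => [i|q qs]; last by apply: sP; rewrite inE qs orbT.
  by rewrite d0 ffunE /=; have := xb i; have := bl i; lra.
have [pO ownO pc] : [/\ supporters p = own p |: O, own p \notin O & cost p = c].
  by apply: sP; rewrite mem_head.
have dO : \sum_(i in O) deduct b x i = \sum_(i in O) b i - \sum_(i in O) x i.
  by rewrite -sumrB; apply: eq_bigr => i _; rewrite ffunE.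
rewrite (eq_bigr (fun q => deduct b x (own q) - pi (own q))); last first.
  by move=> q _; rewrite !ffunE opprD addrA.
rewrite big_cons mulrDr.
(* What [O] pays for [p] alone has to account for what the owner of [p] keeps. *)
suff : (c - l) * (deduct b x (own p) - pi (own p)) <= l * \sum_(i in O) x i.
  by move: IH; rewrite dO mulrBr; lra.
have xO0 : 0 <= \sum_(i in O) x i by rewrite sumr_ge0 // => i _; case/andP: (xb i).
case: xp => [/(_ (own p))|].
  rewrite pO setU11 => xb1.
  apply: (@le_trans _ _ 0); last by rewrite mulr_ge0.
  rewrite mulr_ge0_le0 ?subr_ge0 // ffunE xb1 //.
  by have := pib (own p); lra.
rewrite pO big_setU1 //= pc => xc.
have := xb (own p); have := bl (own p); have := pib (own p) => h1 h2 h3.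
(* If [p] is fully paid, the owner keeps at most [l] and contributed at most [l], so [O] paid at
   least [c - l]. *)
apply: (@le_trans _ _ ((c - l) * l)).
  by rewrite ler_wpM2l ?subr_ge0 // ffunE; lra.
by rewrite mulrC ler_wpM2l //; lra.
Qed.

(** No [k] unselected projects add more than [u *+ k], so no member gets strictly above the cost of
    [T]. *)
Lemma not_EJR_up_to (beta u : R) k (T Ps : {set project I}) (N' : {set voter I}) :
  cohesive beta T N' -> [disjoint T & Ps] -> (k <= #|T|)%N ->
  (forall p, p \notin Ps -> cost p <= u) -> 0 <= u ->
  (forall i, i \in N' -> cost_set (approval i :&: Ps) + u *+ k <= cost_set T) ->
  ~ EJR_up_to beta k Ps.
Proof.
move=> coh dis kT cu u0 sat /(_ _ _ coh) [|[i [P' [iN P'A P'k]]]].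
  by move: dis; rewrite -setI_eq0 => /eqP->; rewrite cards0 ltnNge kT.
rewrite ltNge => /negP; apply; apply: le_trans (sat i iN); rewrite lerD2l.
apply: (@le_trans _ _ (u *+ #|P'|)); last by rewrite ler_wpMn2l.
rewrite -sumr_const; apply: ler_sum => p /(subsetP P'A).
by rewrite !inE => /andP[_]; exact: cu.
Qed.

End Executions.

(** * Instances with a pre-selected part and a group's part *)

(* Projects [inl j], to be pre-selected, have cost [w j] and supporters [e j];
   the [t] projects [inr j] have cost [u] and supporters [N1], the group that
   will witness the failure of EJR. *)
Section TwoParts.

Variables (R : realType) (n s t : nat) (B u : R).
Variables (w : 'I_s -> R) (e : 'I_s -> {set 'I_n}) (N1 : {set 'I_n}).
Hypotheses (B_gt0 : 0 < B) (n_gt0 : (0 < n)%N) (w_gt0 : forall j, 0 < w j).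
Hypotheses (u_gt0 : 0 < u) (e_neq0 : forall j, e j != set0) (N1_neq0 : N1 != set0).

Definition two_part_project : finType := ('I_s + 'I_t)%type.

Definition two_part_approval (i : 'I_n) : {set two_part_project} :=
  [set p : two_part_project |
    match p with inl j => i \in e j | inr _ => i \in N1 end].

Definition two_part_cost (p : two_part_project) : R :=
  match p with inl j => w j | inr _ => u end.

Lemma two_part_cost_gt0 p : 0 < two_part_cost p.
Proof. by case: p. Qed.

Lemma two_part_supported p : exists i, p \in two_part_approval i.
Proof.
case: p => [j|j].
  by have /set0Pn[i ij] := e_neq0 j; exists i; rewrite inE.
by have /set0Pn[i iN] := N1_neq0; exists i; rewrite inE.
Qed.

Definition two_part : instance R :=
  Instance B_gt0 n_gt0 two_part_cost_gt0 two_part_supported.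

Definition left_part : {set project two_part} :=
  [set p : two_part_project | if p is inl _ then true else false].

Lemma supporters_inl j : supporters (inl j : project two_part) = e j.
Proof. by apply/setP => i; rewrite !inE. Qed.

Lemma supporters_inr j : supporters (inr j : project two_part) = N1.
Proof. by apply/setP => i; rewrite !inE. Qed.

Lemma sum_two_part (A : {pred project two_part}) (F : project two_part -> R) :
  \sum_(p in A) F p =
  \sum_(j | inl j \in A) F (inl j) + \sum_(j | inr j \in A) F (inr j).
Proof. exact: big_sumType. Qed.

Lemma sum_left_part (F : project two_part -> R) : \sum_(p in left_part) F p = \sum_j F (inl j).
Proof.
rewrite sum_two_part [X in _ + X]big_pred0 ?addr0; last by move=> j; rewrite inE.
by apply: eq_bigl => j; rewrite inE.
Qed.

Lemma sum_approval_left_part i (F : project two_part -> R) :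
  \sum_(p in approval (i : voter two_part) :&: left_part) F p =
  \sum_(j | i \in e j) F (inl j).
Proof.
rewrite sum_two_part [X in _ + X]big_pred0 ?addr0; last by move=> j; rewrite !inE andbF.
by apply: eq_bigl => j; rewrite !inE andbT.
Qed.

(** The rule budget is exactly the cost of the left part, whose only rivals are the [inr] projects.
    [J] stands for the left projects selected so far. *)
Lemma greedy_two_part tb S :
  (forall J : {set 'I_s}, \sum_(j in J) w j + u <= \sum_j w j ->
     exists2 j, j \notin J & (#|N1| < #|e j|)%N) ->
  greedy_run tb (\sum_j w j) (set0 : {set project two_part}) S -> S = left_part.
Proof.
move=> H run; apply: greedy_run_outcome run (sub0set _).
  by rewrite /cost_set sum_left_part.
move=> [j|j] S0; rewrite inE // => _ SX le.
have [|q qJ qe] := H [set j | (inl j : project two_part) \in S0].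
  apply: le_trans le; rewrite lerD2r /cost_set sum_two_part.
  rewrite [X in _ <= _ + X]big_pred0 ?addr0; last first.
    by move=> r; apply/negP => /(subsetP SX); rewrite inE.
  by rewrite le_eqVlt; apply/orP; left; apply/eqP/eq_bigl => r; rewrite inE.
exists (inl q); first by rewrite !inE andbT; rewrite inE in qJ.
by rewrite supporters_inl supporters_inr.
Qed.

(** Below the level [B / n] the group holds less than [u], so MES is stuck. The witness [T] is the
    set of all [k.+1] projects [inr j]: a member gets at most [u] from the left part, and [k] more
    projects reach at most the cost of [T]. *)
Lemma MES_two_part M tb (mes : voting_rule R) k :
  is_MES M tb mes -> t = k.+1 -> \sum_j w j <= B ->
  (forall i, i \in N1 -> \sum_(j | i \in e j) w j <= u) ->
  u *+ t <= #|N1|%:R / n%:R * (B - \sum_j w j) ->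
  (forall pi : {ffun voter two_part -> R}, prealloc_payments M B left_part pi ->
     [/\ forall i, pi i <= B / n%:R, \sum_i pi i <= \sum_j w j &
         \sum_(i in N1) (B / n%:R - pi i) < u]) ->
  mes two_part B left_part = left_part /\
  ~ EJR_up_to (budget_share B left_part) k left_part.
Proof.
move=> mesP tk wB sat big H.
have cX : cost_set left_part = \sum_j w j by rewrite /cost_set sum_left_part.
split.
  apply: (@MES_stuck _ _ M tb mes B (B / n%:R) _ mesP) => /=.
  - by split; rewrite ?cX // B_gt0 lexx.
  - by rewrite mulrC divfK // pnatr_eq0 -lt0n.
  - move=> pi /H[pil pic poor]; split=> //; first by rewrite cX.
    by move=> [j|j]; rewrite inE // => _; rewrite supporters_inr.
pose T : {set project two_part} := ~: left_part.
have sumT (F : project two_part -> R) : \sum_(p in T) F p = \sum_(j < t) F (inr j).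
  rewrite sum_two_part big_pred0 ?add0r; last by move=> j; rewrite !inE.
  by apply: eq_bigl => j; rewrite !inE.
have cT : cost_set T = u *+ t by rewrite /cost_set sumT sumr_const card_ord.
have kT : #|T| = t.
  rewrite cardsCs setCK.
  have -> : left_part = [set (inl j : project two_part) | j : 'I_s].
    apply/setP => -[j|j]; rewrite inE; symmetry; first by apply/imsetP; exists j.
    by apply/negbTE/imsetP => -[].
  by rewrite card_imset ?card_ord ?card_sum ?card_ord ?addKn //; move=> x y [].
apply: (@not_EJR_up_to _ _ _ u _ T _ N1).
- split.
    apply/subsetP => -[j|j]; rewrite !inE //= => _; apply/bigcapP => i iN.
    by rewrite inE.
  by rewrite cT -mulrA /budget_share divfK ?gt_eqF // cX.
- by rewrite -setI_eq0 setIC setICr.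
- by rewrite kT tk.
- by move=> [j|j]; rewrite inE.
- exact: ltW.
- by move=> i /sat le; rewrite cT tk mulrS lerD2r /cost_set sum_approval_left_part.
Qed.

End TwoParts.

(** * Star instances *)

(* The [j]-th project is supported by [f j], who likes no other project of this
   kind, and by the common supporters [O]. *)
Section Stars.

Variables (R : realType) (k c m n : nat) (f : 'I_m -> 'I_n) (O : {set 'I_n}).
Hypotheses (f_inj : injective f) (fO : forall j, f j \notin O).
Hypotheses (c_gt0 : (0 < c)%N) (mE : m = (k.+1 * c).*2) (nE : n = (m * c).*2).

Definition star_support j := f j |: O.

Definition star_group := [set f j | j in 'I_m].

Lemma star_m_gt0 : (0 < m)%N.
Proof. by rewrite mE double_gt0 muln_gt0. Qed.

Lemma star_n_gt0 : (0 < n)%N.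
Proof. by rewrite nE double_gt0 muln_gt0 star_m_gt0. Qed.

Lemma star_budget_gt0 : 0 < n%:R :> R.
Proof. by rewrite ltr0n star_n_gt0. Qed.

Lemma star_cost_gt0 : 0 < c%:R :> R.
Proof. by rewrite ltr0n. Qed.

Lemma star_support_neq0 j : star_support j != set0.
Proof. by apply/set0Pn; exists (f j); rewrite setU11. Qed.

Lemma star_group_neq0 : star_group != set0.
Proof. by apply/set0Pn; exists (f (Ordinal star_m_gt0)); rewrite imset_f. Qed.

(** The budget [n] normalizes the level [B / n] to 1; all projects, left and right, cost [c]. *)
Definition star : instance R :=
  two_part k.+1 star_budget_gt0 star_n_gt0 (fun _ : 'I_m => star_cost_gt0)
    star_cost_gt0 star_support_neq0 star_group_neq0.

Definition star_left : {set project star} := left_part _ _ _ _ _ _ _.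

Lemma sum_star_left : \sum_(j < m) c%:R = (m * c)%:R :> R.
Proof. by rewrite sumr_const card_ord -mulrnA mulnC. Qed.

Lemma sum_star_group (F : 'I_n -> R) : \sum_(i in star_group) F i = \sum_j F (f j).
Proof. by rewrite big_imset //= => i j _ _; exact: f_inj. Qed.

Lemma sum_star_supported j0 (F : 'I_m -> R) :
  \sum_(j | f j0 \in star_support j) F j = F j0.
Proof.
rewrite (big_pred1 j0) // => j.
by rewrite !inE (negbTE (fO j0)) orbF (inj_eq f_inj) eq_sym.
Qed.

(** The left part costs [m * c], half the budget, so the [m] members are entitled to [m / 2], which
    is [k.+1 * c]. *)
Lemma star_cohesive : c%:R *+ k.+1 =
  #|star_group|%:R / n%:R * (n%:R - \sum_(j < m) c%:R) :> R.
Proof.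
rewrite sum_star_left card_imset // card_ord nE -addnn natrD addrK.
have mc0 : (m * c)%:R != 0 :> R.
  by rewrite pnatr_eq0 -lt0n muln_gt0 star_m_gt0.
have -> : c%:R *+ k.+1 = m%:R / 2 :> R.
  by rewrite mE -muln2 natrM mulfK ?pnatr_eq0 // natrM mulr_natl.
by rewrite -mulr2n -(mulr_natl (m * c)%:R 2) invfM -!mulrA mulVf // mulr1.
Qed.

Lemma MES_star M tb (mes : voting_rule R) :
  is_MES M tb mes ->
  (forall pi : {ffun voter star -> R}, prealloc_payments M n%:R star_left pi ->
     [/\ forall i, pi i <= 1, \sum_i pi i <= \sum_(j < m) c%:R &
         \sum_j (1 - pi (f j)) < c%:R]) ->
  mes star n%:R star_left = star_left /\
  ~ EJR_up_to (budget_share n%:R star_left) k star_left.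
Proof.
move=> mesP H; have n1 : n%:R / n%:R = 1 :> R by rewrite divff ?gt_eqF ?star_budget_gt0.
apply: (MES_two_part mesP) => //.
- by rewrite sum_star_left ler_nat nE -addnn leq_addr.
- by move=> _ /imsetP[j _ ->]; rewrite sum_star_supported.
- by rewrite star_cohesive.
- by move=> pi /H; rewrite n1 sum_star_group.
Qed.

(** With sole supporters and [c = 1], every member has paid exactly the level 1 and receives
    nothing. *)
Lemma MES_star_split tb (mes : voting_rule R) :
  c = 1%N -> O = set0 -> is_MES EqualSplit tb mes ->
  mes star n%:R star_left = star_left /\
  ~ EJR_up_to (budget_share n%:R star_left) k star_left.
Proof.
move=> c1 O0 mesP; apply: MES_star mesP _ => pi ->.
have sE j : star_support j = [set f j] by rewrite /star_support O0 setU0.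
have sup j : #|supporters (inl j : project star)| = 1%N.
  by rewrite supporters_inl sE cards1.
have piE i : equal_split star_left i = \sum_(j | i \in star_support j) 1.
  rewrite ffunE sum_approval_left_part; apply: eq_bigr => j _.
  by rewrite sup divr1 /= c1.
split.
- move=> i; rewrite piE.
  have [/imsetP[j0 _ ->]|iN] := boolP (i \in star_group).
    by rewrite sum_star_supported.
  rewrite big_pred0 ?ler01 // => j; rewrite sE inE.
  by apply: contraNF iN => /eqP->; exact: imset_f.
- by rewrite sum_equal_split /cost_set sum_left_part.
- rewrite big1 ?ltr0n // => j _.
  by rewrite piE sum_star_supported subrr.
Qed.

(** By [style_run_exhausts] with [l = 1], what the group keeps is at most [m / (c - 1)], which the
    choice of [c] puts below the cost [c] of one project. *)
Lemma MES_star_style tb (mes : voting_rule R) :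
  c = k.+2.*2 -> (#|O| <= m)%N -> is_MES MESStyle tb mes ->
  mes star n%:R star_left = star_left /\
  ~ EJR_up_to (budget_share n%:R star_left) k star_left.
Proof.
move=> cE Om mesP; apply: MES_star mesP _ => pi [s sX run].
have n1 : n%:R / n%:R = 1 :> R by rewrite divff ?gt_eqF ?star_budget_gt0.
rewrite n1 in run.
have sumX (F : project star -> R) : \sum_(p <- s) F p = \sum_j F (inl j).
  by rewrite (perm_big _ sX) big_enum sum_left_part.
have [|pib pic] := style_run_bounds run; first by move=> i; rewrite ffunE.
split; first by move=> i; have := pib i; rewrite ffunE => /andP[].
  by move: pic; rewrite sumX.
(* The default voter is never reached, since [s] lists only left projects. *)
pose own (p : project star) : voter star :=
  if p is inl j then f j else Ordinal star_n_gt0.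
have : (c%:R - 1) * \sum_(p <- s) ([ffun=> 1] (own p) - pi (own p)) <=
       1 * \sum_(i in O) ([ffun=> 1] : {ffun voter star -> R}) i.
  apply: style_run_exhausts run _ _.
  - by rewrite ler01 ler1n.
  - by move=> i; rewrite ffunE ler01 lexx.
  move=> p; rewrite (perm_mem sX) mem_enum; case: p => j; rewrite inE // => _.
  by split=> //=; rewrite supporters_inl.
rewrite sumX mul1r; under eq_bigr do rewrite ffunE.
rewrite [X in _ <= X](eq_bigr (fun=> 1)) => [|i _]; last by rewrite ffunE.
rewrite sumr_const /=; set D := \sum_j _ => le.
rewrite ltNge; apply/negP => cD.
have c1 : 0 < c%:R - 1 :> R by rewrite subr_gt0 ltr1n cE.
(* This would give [c - 1 <= 2 * k.+1], whereas [c - 1 = 2 * k + 3]. *)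
have : (c%:R - 1) * c%:R <= m%:R :> R.
  apply: le_trans (_ : (c%:R - 1) * D <= _); first by rewrite ler_pM2l.
  by apply: le_trans le _; rewrite ler_nat.
rewrite -(@natrB R c 1) // -natrM ler_nat mE leqNgt => /negP; apply.
by rewrite doubleMl ltn_pmul2r // cE; lia.
Qed.

(** A left project has [m + 1] supporters against [m] for an [inr] project, and one is left whenever
    an [inr] project is affordable. *)
Lemma greedy_star tb S :
  #|O| = m -> greedy_run tb (m * c)%:R (set0 : {set project star}) S -> S = star_left.
Proof.
move=> Om; rewrite -sum_star_left; apply: greedy_two_part => J le.
have [j jJ] : exists j, j \notin J.
  apply/existsP; rewrite -negb_forall; apply/negP => /forallP JT.
  move: le; rewrite (eq_bigl predT) => [|j]; last by rewrite JT.
  by rewrite gerDl leNgt star_cost_gt0.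
by exists j => //; rewrite card_imset // card_ord cardsU1 fO Om.
Qed.

End Stars.

(** The group is the image of [f]; that of [g] can serve as [O]. There is room since
    [2 * m <= n]. *)
Lemma star_frame k c : (0 < c)%N ->
  let m := (k.+1 * c).*2 in let n := (m * c).*2 in
  exists f g : 'I_m -> 'I_n,
    [/\ injective f, injective g & forall i j, f i != g j].
Proof.
move=> c0 m n; have mn : (m + m <= n)%N by rewrite /n -addnn leq_add // leq_pmulr.
have fn (i : 'I_m) : (i < n)%N.
  by apply: leq_trans mn; apply: ltn_addr.
have gn (i : 'I_m) : (m + i < n)%N by apply: leq_trans mn; rewrite ltn_add2l.
exists (fun i => Ordinal (fn i)), (fun i => Ordinal (gn i)); split.
- by move=> i j [] /val_inj.
- by move=> i j [] /addnI /val_inj.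
- by move=> i j; rewrite -val_eqE /= ltn_eqF // ltn_addr.
Qed.

(** * An instance for Greedy followed by MES with Equal-Split, [k = 1] *)

Section SmallSplit.

Variable R : realType.

Let v0 : 'I_40 := Ordinal (isT : (0 < 40)%N).
Let v1 : 'I_40 := Ordinal (isT : (1 < 40)%N).
Let v2 : 'I_40 := Ordinal (isT : (2 < 40)%N).

(** Each member of the group [v0], [v1] gets 2 + 1 = 3 from the left part, the cost of one of its
    two own projects. These cost 6 = (2 / 40) * (124 - 4), exactly the group's entitlement. *)
Definition small_cost (j : 'I_3) : R := [:: 2; 1; 1]`_j.

Definition small_support (j : 'I_3) : {set 'I_40} :=
  nth set0 [:: v2 |: [set v0; v1]; [set v0]; [set v1]] j.

Lemma small_budget_gt0 : 0 < 124 :> R.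
Proof. by rewrite ltr0n. Qed.

Lemma small_cost_gt0 j : 0 < small_cost j.
Proof. by case: j => -[|[|[|]]] //= jlt; rewrite /small_cost /= ltr0n. Qed.

Lemma small_unit_gt0 : 0 < 3 :> R.
Proof. by rewrite ltr0n. Qed.

Lemma small_support_neq0 j : small_support j != set0.
Proof.
by apply/set0Pn; case: j => -[|[|[|]]] //= jlt;
  [exists v0|exists v0|exists v1]; rewrite !inE.
Qed.

Lemma small_group_neq0 : [set v0; v1] != set0.
Proof. by apply/set0Pn; exists v0; rewrite !inE. Qed.

Definition small : instance R :=
  two_part 2 small_budget_gt0 (isT : (0 < 40)%N) small_cost_gt0 small_unit_gt0
    small_support_neq0 small_group_neq0.

Definition small_left : {set project small} := left_part _ _ _ _ _ _ _.

Lemma sum_small_cost : \sum_j small_cost j = 4.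
Proof. by rewrite !big_ord_recl big_ord0 /small_cost /=; lra. Qed.

Lemma greedy_small tb S :
  greedy_run tb 4 (set0 : {set project small}) S -> S = small_left.
Proof.
rewrite -sum_small_cost; apply: greedy_two_part => J; rewrite sum_small_cost => le.
(* The project of cost 2 has three supporters; once it is taken, cost 3 no longer fits into 4. *)
exists ord0; last by rewrite /small_support /= !cardsU1 !cards1 !inE.
apply/negP => J0; move: le; rewrite (bigD1 ord0) //= {1}/small_cost /=.
have : 0 <= \sum_(j in J | j != ord0) small_cost j.
  by rewrite sumr_ge0 // => j _; exact/ltW/small_cost_gt0.
by lra.
Qed.

Lemma MES_small tb (mes : voting_rule R) :
  is_MES EqualSplit tb mes ->
  mes small 124 small_left = small_left /\
  ~ EJR_up_to (budget_share 124 small_left) 1 small_left.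
Proof.
move=> mesP; apply: (MES_two_part mesP) => //.
- by rewrite sum_small_cost; lra.
- move=> i; rewrite !inE => /orP[] /eqP->;
    by rewrite big_mkcond !big_ord_recl big_ord0 /small_support /small_cost /= !inE /=; lra.
- by rewrite sum_small_cost cards2 /=; lra.
move=> pi ->.
pose share j : R := small_cost j / #|small_support j|%:R.
have piE i : equal_split small_left i = \sum_(j | i \in small_support j) share j.
  by rewrite ffunE sum_approval_left_part; apply: eq_bigr => j _; rewrite supporters_inl.
have share0 j : 0 <= share j by rewrite divr_ge0 // ltW // small_cost_gt0.
have shareE : [/\ share ord0 = 2 / 3, share (lift ord0 ord0) = 1 &
    share (lift ord0 (lift ord0 ord0)) = 1].
  rewrite /share /small_support /small_cost /= !cardsU1 !cards1 !inE /=.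
  by split=> //; rewrite divr1.
case: shareE => s0 s1 s2.
split.
- move=> i; rewrite piE.
  apply: (@le_trans _ _ (\sum_j share j)).
    by rewrite big_mkcond; apply: ler_sum => j _; case: ifP.
  by rewrite !big_ord_recl big_ord0 s0 s1 s2; lra.
- by rewrite sum_equal_split /cost_set sum_left_part.
- have pi5 i : i \in [set v0; v1] -> equal_split small_left i = 5 / 3.
    rewrite piE big_mkcond !big_ord_recl big_ord0 s0 s1 s2 !inE => /orP[] /eqP->;
      by rewrite /small_support /= ?inE /=; lra.
  (* Both members have paid 2 / 3 + 1, which leaves them 43 / 15 < 3 in total. *)
  rewrite (eq_bigr (fun=> 124 / 40 - 5 / 3)) => [|i /pi5-> //].
  by rewrite sumr_const cards2 /=; lra.
Qed.

End SmallSplit.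

(** * From instances to mixed rules *)

(** MES is taken as the only constituent, with [X] given as input. *)
Lemma preselected_violation (R : realType) (mes : voting_rule R) k
    (I : instance R) (X : {set project I}) :
  cost_set X <= budget I ->
  mes I (budget I) X = X /\ ~ EJR_up_to (budget_share (budget I) X) k X ->
  exists (rs1 rs2 : seq (voting_rule R)) (I : instance R) (Bs : seq R)
         (P0 : {set project I}),
    let rs := rs1 ++ mes :: rs2 in
    valid_mixed_input rs Bs P0 /\
    ~ EJR_up_to (mixed_share rs Bs P0 (size rs1)) k (mixed_outcome rs Bs P0).
Proof.
move=> XB [mesX nEJR]; exists [::], [::], I, [:: budget I], X; split.
  by split=> // B'; rewrite inE => /eqP->; rewrite budget_gt0 lexx.
by rewrite /= mesX.
Qed.

Lemma greedy_violation (R : realType) (greedy mes : voting_rule R) k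
    (I : instance R) B1 (X : {set project I}) :
  0 < B1 <= budget I -> greedy I B1 set0 = X ->
  mes I (budget I) X = X /\ ~ EJR_up_to (budget_share (budget I) X) k X ->
  exists (rs2 : seq (voting_rule R)) (I : instance R) (Bs : seq R),
    let rs := [:: greedy, mes & rs2] in
    valid_mixed_input rs Bs (set0 : {set project I}) /\
    ~ EJR_up_to (mixed_share rs Bs (set0 : {set project I}) 1) k
        (mixed_outcome rs Bs (set0 : {set project I})).
Proof.
move=> /andP[B10 B1B] gX [mesX nEJR]; exists [::], I, [:: B1; budget I]; split.
  split=> //=; first by rewrite B1B.
    by move=> B'; rewrite !inE => /orP[] /eqP->; rewrite ?B10 ?budget_gt0 ?lexx.
  by rewrite /cost_set big_set0 ltW.
by rewrite /mixed_share /mixed_stage /= gX mesX.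
Qed.

Theorem theorem5p4 (R : realType) (M : prealloc) (k : nat) (k_gt0 : (0 < k)%N) :
  (forall mes : voting_rule R, is_MES M ArbitraryTies mes ->
     exists (rs1 rs2 : seq (voting_rule R)) (I : instance R) (Bs : seq R)
            (P0 : {set project I}),
       let rs := rs1 ++ mes :: rs2 in
       valid_mixed_input rs Bs P0 /\
       ~ EJR_up_to (mixed_share rs Bs P0 (size rs1)) k (mixed_outcome rs Bs P0))
  /\
  (k = 1%N \/ M = MESStyle ->
   forall greedy mes : voting_rule R,
     is_greedy LargerCostTies greedy -> is_MES M LargerCostTies mes ->
     exists (rs2 : seq (voting_rule R)) (I : instance R) (Bs : seq R),
       let rs := [:: greedy, mes & rs2] in
       valid_mixed_input rs Bs (set0 : {set project I}) /\
       ~ EJR_up_to (mixed_share rs Bs (set0 : {set project I}) 1) k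
           (mixed_outcome rs Bs (set0 : {set project I}))).
Proof.
case: M; split.
(* Equal-Split, general [k]: the star with [c = 1] and empty [O]. *)
- move=> mes mesP.
  have [f [_ [f_inj _ _]]] := star_frame k (isT : (0 < 1)%N).
  have fO j : f j \notin set0 by rewrite inE.
  have := MES_star_split f_inj fO (ltn0Sn 0) erefl erefl erefl erefl mesP.
  apply: preselected_violation.
  by rewrite /cost_set sum_left_part sum_star_left ler_nat -[leqRHS]addnn leq_addr.
- case=> // -> greedy mes greedyP mesP.
  have := MES_small mesP; apply: (@greedy_violation _ _ _ _ _ 4).
  + by apply/andP; split; lra.
  + apply: greedy_small; apply: greedyP; split; first by apply/andP; split; simpl; lra.
    by rewrite /cost_set big_set0; lra.
(* Both MES-Style claims use one star, with [O] the image of [g]. *)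
all: have c0 : (0 < k.+2.*2)%N by [].
all: have [f [g [f_inj g_inj fg]]] := star_frame k c0.
all: have fO j : f j \notin [set g i | i in predT]
  by apply/imsetP => -[i _] /eqP; apply/negP; exact: fg.
all: have cO := card_imset predT g_inj; rewrite card_ord in cO.
all: set m := (k.+1 * _).*2 in f g f_inj g_inj fg fO cO.
- move=> mes mesP.
  have := MES_star_style f_inj fO c0 erefl erefl erefl (eq_leq cO) mesP.
  apply: preselected_violation.
  by rewrite /cost_set sum_left_part sum_star_left ler_nat -[leqRHS]addnn leq_addr.
move=> _ greedy mes greedyP mesP.
have := MES_star_style f_inj fO c0 erefl erefl erefl (eq_leq cO) mesP.
have mc : (m * k.+2.*2 <= (m * k.+2.*2).*2)%N by rewrite -[leqRHS]addnn leq_addr.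
have mc0 : (0 < m * k.+2.*2)%N by rewrite muln_gt0 c0 andbT double_gt0.
apply: (@greedy_violation _ _ _ _ _ (m * k.+2.*2)%:R).
- by rewrite ltr0n mc0 ler_nat.
apply: greedy_star => //; apply: greedyP; split; first by rewrite /= ltr0n mc0 ler_nat.
by rewrite /cost_set big_set0.
Qed.
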